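(* The regularity of the family of ideals $J_{n,m} \subset \mathbf{A}_{n,m}$ ($n,m \ge 1$) is unbounded: for every integer $B$ there exist $n, m \ge 1$ such that the regularity of $J_{n,m}$ is greater than $B$.
   Context: For integers $n,m\ge 1$ let $\mathbf{A}_{n,m} = \mathrm{Sym}(\mathbb{C}^n\otimes\mathbb{C}^m)$, identified with the polynomial ring $\mathbb{C}[x_{i,j} \mid 1\le i\le n,\ 1 \le j \le m]$ (with $x_{i,j}$ corresponding to $e_i\otimes e_j$), graded by $\deg x_{i,j}=1$. The group $\mathrm{GL}_m(\mathbb{C})$ acts on $\mathbf{A}_{n,m}$ by $\mathbb{C}$-algebra automorphisms through its natural action on the factor $\mathbb{C}^m$, i.e. $h\cdot x_{i,j} = \sum_{k=1}^m h_{k,j} x_{i,k}$. The ideal $J_{n,m}$ is the smallest $\mathrm{GL}_m(\mathbb{C})$-stable ideal of $\mathbf{A}_{n,m}$ containing the single degree-$2$ polynomial $x_{1,1}^2 + x_{2,1}^2 + \cdots + x_{n,1}^2$. The regularity of a homogeneous ideal $I\subset \mathbf{A}_{n,m}$ is the Castelnuovo--Mumford regularity of $I$ as a graded $\mathbf{A}_{n,m}$-module, $\sup\{\, j - i \mid \mathrm{Tor}_i^{\mathbf{A}_{n,m}}(I,\mathbb{C})_j \neq 0 \,\}$, where $\mathbb{C}$ is the quotient of $\mathbf{A}_{n,m}$ by the ideal generated by all the variables. *)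

(* Defs.v *)
From HB Require Import structures.
From mathcomp Require Import all_boot all_order all_algebra.
(* mpoly must be imported before the analysis files: their notations at level 2
   are rejected in the other order. *)
From mathcomp Require Import mpoly.
From mathcomp Require Import classical_sets reals constructive_ereal ereal.

Set Implicit Arguments.
Unset Strict Implicit.
Unset Printing Implicit Defensive.

Import GRing.Theory.
Local Open Scope classical_set_scope.
Local Open Scope ring_scope.

Section GradedTor.
Variables (K : fieldType) (N : nat).
Local Notation A := {mpoly K[N]}.

Definition is_ideal (I : set A) : Prop :=
  [/\ I 0, forall p q, I p -> I q -> I (p + q) & forall a p, I p -> I (a * p)].

(* Homogeneous of integer degree: p = 0 when d < 0, and p \is d.-homog when d
   is a natural number. *)
Definition homogeneous (d : int) (p : A) : Prop :=
  forall u : 'X_{1..N}, u \in msupp p -> (mdeg u)%:Z = d.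

(* A sequence  ... -> F_2 -> F_1 -> F_0 -> A, where F_i is the free module of
   row vectors over A of length [rk i] whose k-th basis vector has degree
   [shift i k], i.e. F_i is the sum of the A(- shift i k). The maps multiply
   row vectors on the right by [diff i : F_(i+1) -> F_i] and
   [aug : F_0 -> A]. *)
Record free_sequence := FreeSequence {
  rk : nat -> nat;
  shift : forall i, 'I_(rk i) -> int;
  diff : forall i, 'M[A]_(rk i.+1, rk i);
  aug : 'cV[A]_(rk 0)
}.

(* All maps preserve degrees. *)
Definition is_graded (F : free_sequence) : Prop :=
  (forall k, homogeneous (shift k) (aug F k ord0)) /\
  (forall i (k : 'I_(rk F i.+1)) (l : 'I_(rk F i)),
     homogeneous (shift k - shift l) (diff F i k l)).

(* Exactness of  ... -> F_2 -> F_1 -> F_0 -> I -> 0. *)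
Definition is_exact_onto (I : set A) (F : free_sequence) : Prop :=
  [/\ forall p : A, I p <-> exists v : 'rV[A]_(rk F 0), p%:M = v *m aug F,
      forall v : 'rV[A]_(rk F 0),
        v *m aug F = 0 <-> exists w : 'rV[A]_(rk F 1), v = w *m diff F 0
    & forall i (v : 'rV[A]_(rk F i.+1)),
        v *m diff F i = 0 <->
        exists w : 'rV[A]_(rk F i.+2), v = w *m diff F i.+1].

Definition is_graded_free_resolution (I : set A) (F : free_sequence) : Prop :=
  is_graded F /\ is_exact_onto I F.

(* The complex F (x)_A K, where K is the quotient of A by the ideal generated
   by the variables: the projection A -> K takes constant coefficients. *)
Definition diffK (F : free_sequence) (i : nat) : 'M[K]_(rk F i.+1, rk F i) :=
  map_mx (mcoeff 0%MM) (diff F i).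

Definition is_cycle (F : free_sequence) (i : nat) : 'rV[K]_(rk F i) -> Prop :=
  match i with
  | 0 => fun _ => True
  | i'.+1 => fun v => v *m diffK F i' = 0
  end.

Definition is_boundary (F : free_sequence) (i : nat) (v : 'rV[K]_(rk F i)) :=
  exists w : 'rV[K]_(rk F i.+1), v = w *m diffK F i.

(* Tor_i(I, K)_j <> 0: for some graded free resolution F of I, the homology of
   F (x)_A K at F_i has a nonzero class of degree j. As usual this does not
   depend on the choice of F. *)
Definition Tor_neq0 (I : set A) (i : nat) (j : int) : Prop :=
  exists2 F : free_sequence, is_graded_free_resolution I F &
    exists v : 'rV[K]_(rk F i),
      [/\ forall k, v ord0 k != 0 -> shift k = j,
          is_cycle v & ~ is_boundary v].

Definition regularity (R : realType) (I : set A) : \bar R :=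
  ereal_sup [set ((ij.2 - ij.1%:Z)%:~R)%:E | ij in
               [set ij : nat * int | Tor_neq0 I ij.1 ij.2]].

End GradedTor.

Section IdealJ.
Variables (K : fieldType) (n m : nat).
(* The variable x_{i,j} is indexed by [mxvec_index i j : 'I_(n * m)]. *)
Local Notation A := {mpoly K[n * m]}.

Definition var (i : 'I_n) (j : 'I_m) : A := 'X_(mxvec_index i j).

(* The algebra endomorphism x_{i,j} |-> \sum_k h_{k,j} x_{i,k}. *)
Definition GL_act (h : 'M[K]_m) (p : A) : A :=
  let hx : 'M[A]_(n, m) := \matrix_(i, j) \sum_k h k j *: var i k in
  p \mPo [tuple mxvec hx ord0 u | u < n * m].

Definition GL_stable (I : set A) : Prop :=
  forall (h : 'M[K]_m) (p : A), h \in unitmx -> I p -> I (GL_act h p).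

(* Indices start at 0, so the hypothesis [0 < m] provides the first column. *)
Definition idealJ (m_gt0 : (0 < m)%N) : set A :=
  smallest [set I | is_ideal I /\ GL_stable I]
           [set \sum_(i < n) var i (Ordinal m_gt0) ^+ 2].

End IdealJ.

(* Main.v *)
From HB Require Import structures.
Require Import Defs.
From mathcomp Require Import all_boot all_order all_algebra.
From mathcomp Require Import perm mpoly boolp.
From mathcomp Require Import classical_sets reals constructive_ereal ereal.
From mathcomp Require Import complex.
From mathcomp Require Import ring zify.

(** Write [X] for the [n] x [m] matrix of variables. The ideal [J_{n,m}] is
generated by the [c = m(m+1)/2] entries of [X^T X] on and above the diagonal
([idealJE]): permutations and transvections produce all of them from the first
one, and their span is stable under [GL_m]. For [n = m^2] these quadrics form
a regular sequence, so the Koszul complex is a minimal graded free resolution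
of [J_{n,m}]. Its last module is free of rank one, sits in homological degree
[c - 1] and is generated in degree [2c]; hence the regularity is at least
[c + 1], which is unbounded ([Tor_koszul], [Tor_idealJ]).

Regularity of the sequence is proved through its syzygies. A syzygy of [f] is
Koszul when it has the form [f M] with [M] antisymmetric. If all syzygies of
[f_0, ..., f_k] are Koszul and 2 is nonzero, then [f_k] is a nonzerodivisor
modulo [f_0, ..., f_{k-1}] ([only_koszul_syzygies_nonzerodivisor]). For
homogeneous [f], the property lifts along a substitution of a linear form [l]
for a variable [x] ([only_koszul_subst]): modulo [y = x - l] a syzygy of [f]
becomes a syzygy of the substituted sequence, so it is Koszul up to a multiple
[y a'], where [a'] is again a syzygy because [y] is a nonzerodivisor.
Iterating, a syzygy is Koszul modulo every power of [y], and comparing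
homogeneous components shows that it is Koszul.

It remains to find a linear specialization of [X] under which the quadrics
become nonzero multiples of squares of distinct variables, whose syzygies are
easily seen to be Koszul ([only_koszul_squares]). Index the rows of [X] by
pairs [(a, b)] of columns, take one indeterminate [t_{ab} = t_{ba}] for each
unordered pair, and let [i] be a square root of -1. Setting
[x_{(a,b),j} = (delta_{ja} + i delta_{jb}) t_{ab}] gives
[sum_{a,b} x_{(a,b),j} x_{(a,b),k} = 2 i t_{jk}^2] ([specialize_gram]),
because the remaining contributions
[sum_{a,b} (delta_{ja} delta_{ka} - delta_{jb} delta_{kb}) t_{ab}^2]
cancel by symmetry. *)

Set Implicit Arguments.
Unset Strict Implicit.
Unset Printing Implicit Defensive.
Import GRing.Theory Num.Theory Order.POrderTheory.
Local Open Scope ring_scope.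

(** * Koszul syzygies *)

Definition ideal_span (A : comNzRingType) (f : nat -> A) (k : nat) (p : A)
    : Prop :=
  exists b : nat -> A, p = \sum_(i < k) b i * f i.

Definition koszul_relation (A : comNzRingType) (f : nat -> A) (k : nat)
    (a : nat -> A) : Prop :=
  exists2 M : nat -> nat -> A, forall i j, M j i = - M i j &
    forall j, (j < k)%N -> a j = \sum_(i < k) M i j * f i.

Definition only_koszul_syzygies (A : comNzRingType) (f : nat -> A) (k : nat)
    : Prop :=
  forall a : nat -> A, \sum_(i < k) a i * f i = 0 -> koszul_relation f k a.

Section Span.
Variables (A : comNzRingType) (f : nat -> A) (k : nat).

Lemma ideal_span0 : ideal_span f k 0.
Proof. by exists (fun=> 0); rewrite big1 // => i _; rewrite mul0r. Qed.

Lemma ideal_spanD p q :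
  ideal_span f k p -> ideal_span f k q -> ideal_span f k (p + q).
Proof.
move=> [a ->] [b ->]; exists (fun i => a i + b i).
by rewrite -big_split; apply: eq_bigr => i _; rewrite mulrDl.
Qed.

Lemma ideal_spanM a p : ideal_span f k p -> ideal_span f k (a * p).
Proof.
move=> [b ->]; exists (fun i => a * b i).
by rewrite mulr_sumr; apply: eq_bigr => i _; rewrite mulrA.
Qed.

Lemma ideal_span_gen i : (i < k)%N -> ideal_span f k (f i).
Proof.
move=> lt_ik; exists (fun j => (j == i)%:R).
rewrite (bigD1 (Ordinal lt_ik)) //= eqxx mul1r big1 ?addr0 // => j ne_ji.
suff -> : (val j == i) = false by rewrite mul0r.
by apply: contraNF ne_ji => /eqP e; apply/eqP/val_inj.
Qed.

(** Subtracting the Koszul relations between [f k] and the earlier [f i] kills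
the last coordinate of a syzygy: that coordinate is a combination of the
earlier [f i] because [f k] is a nonzerodivisor modulo them. *)
Lemma only_koszul_syzygiesS :
  (forall p, ideal_span f k (p * f k) -> ideal_span f k p) ->
  only_koszul_syzygies f k -> only_koszul_syzygies f k.+1.
Proof.
move=> nzd onlyK a; rewrite big_ord_recr /= => syz_a.
have [|b a_k] := nzd (a k).
  exists (fun i => - a i); apply/eqP; rewrite -subr_eq0 addrC; apply/eqP.
  rewrite -[RHS]syz_a; congr (_ + _); rewrite -sumrN.
  by apply: eq_bigr => i _; rewrite mulNr opprK.
have [|M antiM defM] := onlyK (fun i => a i + b i * f k).
  rewrite -[RHS]syz_a a_k mulr_suml -big_split /=; apply: eq_bigr => i _.
  by rewrite mulrDl mulrAC.
(* Border M with b as last column and - b as last row. *)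
pose M' i j := if i == k then (if j == k then 0 else - b j)
               else if j == k then b i else M i j.
exists M' => [i j|j].
  by rewrite /M'; do 2![case: eqP => _]; rewrite ?oppr0 ?opprK.
have M'l (i : 'I_k) j' : M' i j' = if j' == k then b i else M i j'.
  by rewrite /M' (ltn_eqF (ltn_ord i)).
rewrite ltnS leq_eqVlt big_ord_recr /= => /predU1P[->|lt_jk].
  rewrite {2}/M' !eqxx mul0r addr0 {1}a_k.
  by apply: eq_bigr => i _; rewrite M'l eqxx.
rewrite {2}/M' eqxx (ltn_eqF lt_jk) mulNr; apply/eqP; rewrite eq_sym subr_eq.
rewrite defM //; apply/eqP/eq_bigr => i _.
by rewrite M'l (ltn_eqF lt_jk).
Qed.

End Span.

(** A relation [p * f k = \sum_i b i * f i] is a syzygy with last coordinate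
[- p]. Being Koszul, that coordinate is a combination of the [f i] in which
[f k] has coefficient zero, since the diagonal of an antisymmetric matrix
vanishes. *)
Lemma only_koszul_syzygies_nonzerodivisor (A : idomainType) (f : nat -> A) k p :
  2%:R != 0 :> A -> only_koszul_syzygies f k.+1 ->
  ideal_span f k (p * f k) -> ideal_span f k p.
Proof.
move=> nz2 onlyK [b def_pf].
have [|M antiM defM] := onlyK (fun i => if i == k then - p else b i).
  rewrite big_ord_recr /= eqxx mulNr def_pf; apply/eqP; rewrite subr_eq0.
  by apply/eqP/eq_bigr => i _; rewrite (ltn_eqF (ltn_ord i)).
have Mkk : M k k = 0.
  apply/eqP; move/eqP: (antiM k k); rewrite -addr_eq0 -mulr2n -mulr_natl.
  by rewrite mulf_eq0 (negPf nz2).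
move: (defM k (ltnSn k)); rewrite eqxx big_ord_recr /= Mkk mul0r addr0.
move/(congr1 -%R); rewrite opprK -sumrN => ->.
by exists (fun i => - M i k); apply: eq_bigr => i _; rewrite mulNr.
Qed.

(** * Substituting a linear form for a variable *)

Section Substitution.
Variables (K : fieldType) (N : nat).
Local Notation A := {mpoly K[N]}.
Implicit Types (p q l : A) (f : nat -> A).

Definition subst (u : 'I_N) l : A -> A :=
  comp_mpoly [tuple if i == u then l else 'X_i | i < N].

HB.instance Definition _ u l := GRing.RMorphism.on (subst u l).
HB.instance Definition _ u l := GRing.Linear.on (subst u l).

Lemma substX u l i : subst u l 'X_i = if i == u then l else 'X_i.
Proof. by rewrite /subst comp_mpolyXU -tnth_nth tnth_mktuple. Qed.

Lemma subst_id u p : subst u 'X_u p = p.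
Proof.
rewrite -[RHS]comp_mpoly_id; congr comp_mpoly; apply: eq_from_tnth => i.
by rewrite !tnth_mktuple; case: eqP => // ->.
Qed.

(** The polynomials satisfying this congruence form a subalgebra that contains
the variables. *)
Lemma subst_congr u l p : exists q, p - subst u l p = ('X_u - l) * q.
Proof.
pose P p := exists q, p - subst u l p = ('X_u - l) * q.
have P0 c : P c%:MP.
  by exists 0; rewrite mulr0 /subst comp_mpolyC subrr.
have PD p1 p2 : P p1 -> P p2 -> P (p1 + p2).
  move=> [q1 e1] [q2 e2]; exists (q1 + q2).
  by rewrite rmorphD mulrDr -e1 -e2 opprD addrACA.
have PM p1 p2 : P p1 -> P p2 -> P (p1 * p2).
  move=> [q1 e1] [q2 e2]; exists (q1 * p2 + subst u l p1 * q2).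
  rewrite rmorphM /= mulrDr mulrA -e1 (mulrCA ('X_u - l)) -e2; ring.
have PX i : P 'X_i.
  rewrite /P substX; case: eqP => [->|_]; first by exists 1; rewrite mulr1.
  by exists 0; rewrite mulr0 subrr.
have PXm m : P 'X_[m].
  rewrite mpolyXE_id; apply: big_ind => // [|i _]; first exact: P0 1.
  elim: (m i) => [|d IHd]; first exact: P0 1.
  by rewrite exprS; apply: PM.
elim/mpolyind: p => [|c m p _ _ Pp]; first by have := P0 0; rewrite mpolyC0.
by apply: (PD) => //; rewrite -mul_mpolyC; apply: (PM).
Qed.

Lemma X_neq0 (u : 'I_N) : 'X_u != 0 :> A.
Proof. by rewrite -msupp_eq0 msuppX. Qed.

End Substitution.

(** * Squares of distinct variables *)

Section Base.
Variables (K : fieldType) (N : nat).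
Local Notation A := {mpoly K[N]}.
Implicit Types (f a : nat -> A).

(** The substitution of 0 for the variable [x] kills [x * p], so subtracting it
from [x * p = \sum_i b i * f i] replaces each [b i] by a multiple of [x], which
can be cancelled. *)
Lemma ideal_span_divX (u : 'I_N) f k (p : A) :
  (forall i, (i < k)%N -> subst u 0 (f i) = f i) ->
  ideal_span f k ('X_u * p) -> ideal_span f k p.
Proof.
move=> fixf [b def_p].
have /choice[c def_c] : forall i, exists q, b i - subst u 0 (b i) = 'X_u * q.
  by move=> i; have [q] := subst_congr u 0 (b i); rewrite subr0; exists q.
exists c; apply: (mulfI (X_neq0 K u)); rewrite mulr_sumr.
under eq_bigr do rewrite mulrA -def_c mulrBl.
rewrite sumrB -def_p -[LHS]subr0; congr (_ - _).
have e0 := congr1 (subst u 0) def_p; rewrite rmorphM /= substX eqxx mul0r in e0.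
rewrite [LHS]e0 {e0}.
by rewrite rmorph_sum /=; apply: eq_bigr => i _; rewrite rmorphM /= fixf.
Qed.

Lemma only_koszul_squares (c : nat -> K) (T : nat -> 'I_N) k :
  (forall i, (i < k)%N -> c i != 0) ->
  (forall i j, (i < k)%N -> (j < k)%N -> T i = T j -> i = j) ->
  only_koszul_syzygies (fun i => c i *: 'X_(T i) ^+ 2) k.
Proof.
elim: k => [|k IHk] nz_c injT.
  by move=> a _; exists (fun _ _ => 0) => // i j; rewrite oppr0.
apply: only_koszul_syzygiesS => [p|]; last first.
  apply: IHk => [i /ltnW/nz_c //|i j lt_ik lt_jk].
  by apply: injT; rewrite ltnW.
rewrite /= -scalerAr => /(ideal_spanM (c k)^-1%:MP).
rewrite mul_mpolyC scalerA mulVf ?nz_c // scale1r mulrC expr2 -mulrA.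
suff fixf i : (i < k)%N ->
    subst (T k) 0 (c i *: 'X_(T i) ^+ 2) = c i *: 'X_(T i) ^+ 2.
  (* The two factors 'X_(T k) are cancelled one at a time. *)
  by move=> /(ideal_span_divX fixf)/(ideal_span_divX fixf).
move=> lt_ik; rewrite linearZ rmorphXn /= substX.
case: eqP => // /injT; rewrite leqnn ltnS (ltnW lt_ik) => /(_ isT isT) e.
by rewrite e ltnn in lt_ik.
Qed.

End Base.

(** * Lifting Koszul syzygies from a linear specialization *)

Section Lift.
Variables (K : fieldType) (N : nat).
Hypothesis nz2 : 2%:R != 0 :> K.
Local Notation A := {mpoly K[N]}.
Implicit Types (f a : nat -> A).

Lemma mpoly_nz2 : 2%:R != 0 :> A.
Proof. by rewrite -mpolyC_nat mpolyC_eq0. Qed.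

(** Koszul relations are syzygies: the form [f M f^T] equals its own
opposite. *)
Lemma antisymmetric_form0 (M : nat -> nat -> A) f k :
  (forall i j, M j i = - M i j) ->
  \sum_(j < k) (\sum_(i < k) M i j * f i) * f j = 0.
Proof.
move=> antiM; set s := LHS.
have : s = - s.
  rewrite {1}/s; under eq_bigr do rewrite mulr_suml.
  rewrite exchange_big /= -sumrN; apply: eq_bigr => i _.
  rewrite mulr_suml -sumrN; apply: eq_bigr => j _.
  by rewrite (antiM j) !mulNr mulrAC.
move/eqP; rewrite -addr_eq0 -mulr2n -mulr_natl mulf_eq0 (negPf mpoly_nz2).
by move/eqP.
Qed.

Lemma pihomogMr D e (p q : A) : q \is e.-homog ->
  pihomog mdeg D (p * q) =
    if (e <= D)%N then pihomog mdeg (D - e) p * q else 0.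
Proof.
move=> hq; elim/mpolyind: p => [|c m p _ _ IHp].
  by rewrite mul0r !linear0 mul0r if_same.
rewrite mulrDl -scalerAl !linearP /= IHp {IHp}.
have hXq : 'X_[m] * q \is (mdeg m + e).-homog by rewrite dhomogM // dhomogX.
have -> : pihomog mdeg D ('X_[m] * q) =
    if (mdeg m + e == D)%N then 'X_[m] * q else 0.
  case: eqP => [<-|/eqP ne]; first exact: pihomog_dE.
  exact: (pihomog_ne0 ne).
case: leqP => [le_eD|lt_De].
  rewrite pihomogX -(eqn_add2r e _ (D - e)) subnK // mulrDl; case: ifP => _.
    by rewrite scalerAl.
  by rewrite !scaler0 mul0r.
rewrite gtn_eqF ?scaler0 ?addr0 //.
by apply: leq_trans lt_De _; apply: leq_addl.
Qed.

Variables (u : 'I_N) (l : A) (e k : nat) (f : nat -> A).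
Hypotheses (hl : l \is 1.-homog) (hf : forall i, (i < k)%N -> f i \is e.-homog).
Hypothesis neXl : l != 'X_u.

Let y := 'X_u - l.
Let nz_y : y != 0. Proof. by rewrite subr_eq0 eq_sym. Qed.

Let h_y : y \is 1.-homog.
Proof. by apply: (rpredB _ hl); rewrite dhomogX /= mdeg1. Qed.

Hypothesis onlyK : only_koszul_syzygies (fun i => subst u l (f i)) k.

(** Modulo [y], the syzygy [a] of [f] and its image under the substitution
agree, so [a] is a Koszul relation plus a multiple [y * a']; as [y] is a
nonzerodivisor, [a'] is again a syzygy. *)
Lemma syzygy_step a : \sum_(i < k) a i * f i = 0 ->
  exists (M : nat -> nat -> A) (a' : nat -> A),
  [/\ forall i j, M j i = - M i j,
      forall j, (j < k)%N -> a j = \sum_(i < k) M i j * f i + y * a' j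
    & \sum_(i < k) a' i * f i = 0].
Proof.
move=> syz_a; have [|M antiM defM] := onlyK (a := fun i => subst u l (a i)).
  have e0 := congr1 (subst u l) syz_a; rewrite rmorph_sum rmorph0 /= in e0.
  rewrite -[RHS]e0.
  by apply: eq_bigr => i _; rewrite rmorphM.
have /choice[q def_q] := fun i => subst_congr u l (a i).
have /choice[r def_r] := fun i => subst_congr u l (f i).
pose a' j := q j - \sum_(i < k) M i j * r i.
have def_a j : (j < k)%N -> a j = \sum_(i < k) M i j * f i + y * a' j.
  move=> lt_jk; rewrite mulrBr -def_q defM // mulr_sumr.
  under [X in _ - X]eq_bigr do rewrite mulrCA -def_r mulrBr.
  by rewrite sumrB opprB addrC addrA subrK subrK.
exists M, a'; split=> //; apply: (mulfI nz_y); rewrite mulr0.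
rewrite -[RHS]subr0 -[X in _ = X - _]syz_a.
rewrite -[X in _ = _ - X](antisymmetric_form0 f k antiM) -sumrB mulr_sumr.
apply: eq_bigr => j _; rewrite -mulrBl def_a //.
by rewrite addrAC subrr add0r mulrA.
Qed.

Lemma syzygy_iter n a : \sum_(i < k) a i * f i = 0 ->
  exists (M : nat -> nat -> A) (a' : nat -> A),
  [/\ forall i j, M j i = - M i j,
      forall j, (j < k)%N -> a j = \sum_(i < k) M i j * f i + a' j * y ^+ n
    & \sum_(i < k) a' i * f i = 0].
Proof.
elim: n a => [|n IHn] a syz_a.
  exists (fun _ _ => 0), a; split=> // [i j|j _]; first by rewrite oppr0.
  by rewrite big1 ?add0r ?expr0 ?mulr1 // => i _; rewrite mul0r.
have [M1 [a1 [anti1 def_a /IHn]]] := syzygy_step syz_a.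
case=> [M2 [a2 [anti2 def_a1 syz_a2]]].
exists (fun i j => M1 i j + y * M2 i j), a2; split=> // [i j|j lt_jk].
  by rewrite anti1 anti2 opprD mulrN.
rewrite def_a // def_a1 // mulrDr addrA exprS [in RHS]mulrCA; congr (_ + _).
rewrite mulr_sumr -big_split /=; apply: eq_bigr => i _.
by rewrite [RHS]mulrDl mulrA.
Qed.

(** The error term [a' * y ^+ D.+1] has no component of degree [D], and the
component of [\sum_i M i j * f i] in degree [D] only involves the component of
[M] in degree [D - e]. *)
Lemma koszul_relation_pihomog D a : \sum_(i < k) a i * f i = 0 ->
  koszul_relation f k (fun j => pihomog mdeg D (a j)).
Proof.
move=> /(syzygy_iter D.+1)[M [a' [antiM def_a _]]].
exists (fun i j => if (e <= D)%N then pihomog mdeg (D - e) (M i j) else 0).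
  by move=> i j; rewrite antiM; case: ifP => _; rewrite ?oppr0 ?linearN.
move=> j lt_jk; rewrite def_a // linearD linear_sum /=.
rewrite (@pihomogMr D D.+1) ?ltnn; last first.
  by have := dhomogMn D.+1 h_y; rewrite mul1n.
rewrite addr0; apply: eq_bigr => i _; rewrite (@pihomogMr D e) ?hf //.
by case: ifP; rewrite ?mul0r.
Qed.

Lemma only_koszul_subst : only_koszul_syzygies f k.
Proof.
move=> a syz_a.
have /choice[M /all_and2 [antiM defM]] : forall D, exists M : nat -> nat -> A,
    (forall i j, M j i = - M i j) /\
    forall j, (j < k)%N -> pihomog mdeg D (a j) = \sum_(i < k) M i j * f i.
  by move=> D; have [M ? ?] := koszul_relation_pihomog D syz_a; exists M.
pose n := (\max_(j < k) msize (a j))%N.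
exists (fun i j => \sum_(D < n) M D i j) => [i j|j lt_jk].
  by rewrite -sumrN; apply: eq_bigr => D _; apply: antiM.
have le_an : (msize (a j) <= n)%N by apply: (bigmax_sup (Ordinal lt_jk)).
rewrite (pihomog_partitionE le_an).
under eq_bigr do rewrite defM //.
by rewrite exchange_big; apply: eq_bigr => i _; rewrite mulr_suml.
Qed.

End Lift.

(** * The Koszul complex as an iterated mapping cone *)

Section Koszul.
Variables (K : fieldType) (N : nat).
Local Notation A := {mpoly K[N]}.
Implicit Types F : free_sequence K N.

(** A free sequence resolves an ideal, and its augmentation to the ring plays
the part of one more differential. The following three definitions view it as
the last differential, onto a module of rank one generated in degree 0, so that
the cone is given by one formula in all degrees. *)
Definition prev_rk F i : nat := if i is j.+1 then rk F j else 1.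

Definition prev_shift F i : 'I_(prev_rk F i) -> int :=
  match i with 0 => fun=> 0 | j.+1 => @shift _ _ F j end.

Definition prev_diff F i : 'M[A]_(rk F i, prev_rk F i) :=
  match i with 0 => aug F | j.+1 => diff F j end.

(** The mapping cone of multiplication by [f], an element of degree [e], on
the complex [F] augmented to the ring: if [F] resolves [I], it is the candidate
resolution of [I + (f)]. *)
Definition cone F (f : A) (e : int) : free_sequence K N :=
  @FreeSequence K N (fun i => rk F i + prev_rk F i)%N
    (fun i k => match split k with
                | inl a => shift a
                | inr b => prev_shift b + e
                end)
    (fun i => block_mx (diff F i) 0 (f%:M : 'M_(rk F i)) (- prev_diff F i))
    (col_mx (aug F) f%:M).

Definition koszul (f : nat -> A) (e : int) : nat -> free_sequence K N :=
  fix koszul k := if k is j.+1 then cone (koszul j) (f j) e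
                  else FreeSequence (fun _ (_ : 'I_0) => 0) (fun=> 0) 0.

Lemma homogeneous0 d : homogeneous d (0 : A).
Proof. by move=> m; rewrite msupp0. Qed.

Lemma homogeneousN d (p : A) : homogeneous d p -> homogeneous d (- p).
Proof. by move=> hp m; rewrite (perm_mem (msuppN p)) => /hp. Qed.

(** Differentials and augmentation preserve degrees and vanish modulo the
variables. *)
Definition minimal_graded F : Prop :=
  forall i k l, homogeneous (shift k - @prev_shift F i l) (prev_diff F i k l) /\
                (prev_diff F i k l)@_0 = 0.

Lemma cone_minimal_graded F (f : A) (e : int) :
  homogeneous e f -> f@_0 = 0 ->
  minimal_graded F -> minimal_graded (cone F f e).
Proof.
move=> hf f0 hF [|i] k l.
  rewrite [prev_diff _ _]/= [shift _]/= [prev_shift _]/=.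
  rewrite mxE; case: (split k) => [a|b]; first exact: hF 0%N a l.
  rewrite !mxE !ord1 eqxx mulr1n /= subr0 add0r; split=> //.
rewrite [prev_diff _ _]/= [shift _]/= [prev_shift _]/=.
rewrite mxE; case: (split k) => [a|b].
  rewrite mxE; case: (split l) => [c|d]; first exact: hF i.+1 a c.
  by rewrite mxE; split; [exact: homogeneous0 | rewrite mcoeff0].
rewrite mxE; case: (split l) => [c|d]; rewrite mxE.
  case: eqP => [->|_]; last first.
    by rewrite mulr0n; split; [exact: homogeneous0 | rewrite mcoeff0].
  by rewrite mulr1n addrAC subrr add0r.
rewrite opprD addrACA subrr addr0 mcoeffN; have [h0 ->] := hF i b d.
by split; [exact: homogeneousN | rewrite oppr0].
Qed.

(** A cycle [(a, b)] of the cone satisfies [d a + f b = 0], with [b] a cycle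
of [F]. In positive degrees [b] is a boundary because [F] is exact; in degree
0, [b] is a polynomial with [b * f] in [I], and here the nonzerodivisor
hypothesis puts [b] in [I], the image of the augmentation. In both cases
[b = d b'], and then [a + f b'] is a cycle of [F], hence a boundary [d a'], so
that [(a, b)] is the image of [(a', - b')]. *)
Lemma cone_exact F (I : A -> Prop) (f : A) (e : int) :
  is_exact_onto I F -> (forall p, I (p * f) -> I p) ->
  is_exact_onto (fun p => exists2 q, I q & exists b, p = q + b * f)
                (cone F f e).
Proof.
move=> [ex0 ex1 exS] nzd.
have complex0 : diff F 0 *m aug F = 0.
  apply/row_matrixP => i; rewrite row0 row_mul.
  by apply/ex1; exists (delta_mx 0 i); rewrite rowE.
have complexS i : diff F i.+1 *m diff F i = 0.
  apply/row_matrixP => j; rewrite row0 row_mul.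
  by apply/exS; exists (delta_mx 0 j); rewrite rowE.
have exact_prev i (v : 'rV[A]_(rk F i)) : v *m prev_diff F i = 0 <->
    exists w : 'rV[A]_(rk F i.+1), v = w *m diff F i.
  by case: i v.
have complex_prev i : diff F i *m prev_diff F i = 0 by case: i.
split.
- move=> p; split=> [[q /ex0[v def_q] [b ->]]|[v]].
    exists (row_mx v b%:M); rewrite mul_row_col -def_q raddfD /=.
    by rewrite -scalar_mxM.
  rewrite -[v]hsubmxK mul_row_col => def_p.
  pose q := (lsubmx v *m aug F) ord0 ord0.
  exists q; first by apply/ex0; exists (lsubmx v); rewrite -mx11_scalar.
  exists (rsubmx v ord0 ord0).
  move/matrixP/(_ ord0 ord0): def_p; rewrite [LHS]mxE eqxx mulr1n mxE => ->.
  congr (_ + _).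
  by rewrite !mxE zmodp.big_ord1 !mxE eqxx mulr1n.
- move=> v; split=> [|[w ->]]; last first.
    rewrite -mulmxA mul_block_col complex0 add0r mul0mx.
    by rewrite mulNmx scalar_mxC subrr col_mx0 mulmx0.
  rewrite -[v]hsubmxK mul_row_col; set a := lsubmx v; set b := rsubmx v.
  move=> /eqP; rewrite addr_eq0 => /eqP ab0.
  have /nzd/ex0[b' def_b] : I (b ord0 ord0 * f).
    apply/ex0; exists (- a); rewrite mulNmx ab0 opprK.
    by rewrite scalar_mxM -mx11_scalar.
  rewrite -mx11_scalar in def_b.
  have /ex1[a' def_a] : (a + f *: b') *m aug F = 0.
    by rewrite mulmxDl ab0 -scalemxAl -def_b mul_mx_scalar addrC subrr.
  exists (row_mx a' (- b')); rewrite /= mul_row_block mulmx0 add0r.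
  rewrite mulNmx mulmxN mulNmx opprK -def_a mul_mx_scalar addrK -def_b.
  by rewrite hsubmxK.
- move=> i v; split=> [|[w ->]]; last first.
    rewrite -mulmxA mulmx_block complexS !mul0mx !mulmx0 !add0r.
    rewrite -[prev_diff F i.+1]/(diff F i) mulmxN !mulNmx opprK complex_prev.
    rewrite scalar_mxC subrr.
    by rewrite block_mx0 mulmx0.
  rewrite -[v]hsubmxK mul_row_block -row_mx0; set a := lsubmx v.
  set b := rsubmx v; rewrite mulmx0 add0r mulmxN => /eq_row_mx[ab0 b0].
  have /exact_prev[b' def_b] : b *m prev_diff F i = 0.
    by apply/eqP; rewrite -oppr_eq0; apply/eqP.
  have /exS[a' def_a] : (a + f *: b') *m diff F i = 0.
    by rewrite mulmxDl -scalemxAl -def_b -mul_mx_scalar.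
  exists (row_mx a' (- b')); rewrite /= mul_row_block mulmx0 add0r.
  rewrite mulNmx mulmxN mulNmx opprK -def_a mul_mx_scalar addrK -def_b.
  by rewrite hsubmxK.
Qed.

Lemma koszul_exact (f : nat -> A) (e : int) k :
  (forall j, (j < k)%N ->
     forall p, ideal_span f j (p * f j) -> ideal_span f j p) ->
  is_exact_onto (ideal_span f k) (koszul f e k).
Proof.
elim: k => [|k IHk] nzd.
  split=> [p|v|i v]; first last.
  - by split=> _; [exists 0 | ]; rewrite [LHS]thinmx0 // [RHS]thinmx0.
  - by split=> _; [exists 0 | ]; rewrite [v]thinmx0 ?mul0mx // [RHS]thinmx0.
  split=> [[b ->]|[v /matrixP/(_ ord0 ord0)]].
    by exists 0; rewrite big_ord0 mul0mx raddf0.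
  by rewrite mxE eqxx mulr1n mulmx0 mxE => ->; apply: ideal_span0.
have [ex0 ex1 exS] := cone_exact e (IHk (fun j lt_jk => nzd j (ltnW lt_jk)))
                                 (nzd k (ltnSn k)).
split=> // p; rewrite -ex0; split=> [[b ->]|[q [b ->] [c ->]]].
  rewrite big_ord_recr; exists (\sum_(i < k) b i * f i); first by exists b.
  by exists (b k).
exists (fun i => if i == k then c else b i); rewrite big_ord_recr /= eqxx.
by congr (_ + _); apply: eq_bigr => i _; rewrite (ltn_eqF (ltn_ord i)).
Qed.

Lemma koszul_minimal_graded (f : nat -> A) (e : int) k :
  (forall j, (j < k)%N -> homogeneous e (f j) /\ (f j)@_0 = 0) ->
  minimal_graded (koszul f e k).
Proof.
elim: k => [|k IHk] hf; first by case=> [|i] [].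
have [h0 f0] := hf k (ltnSn k).
by apply: cone_minimal_graded => //; apply: IHk => j /ltnW/hf.
Qed.

(** The exterior product of all the generators. *)
Lemma koszul_top (f : nat -> A) (e : int) k :
  exists l : 'I_(prev_rk (koszul f e k) k), prev_shift l = e *+ k.
Proof.
elim: k => [|k [l shift_l]]; first by exists ord0.
exists (rshift (rk (koszul f e k) k) l) => /=.
by rewrite -[rshift _ l]/(unsplit (inr l)) unsplitK shift_l mulrSr.
Qed.

(** The differentials vanish modulo the variables, so every basis vector of
the Koszul complex gives a nonzero class in Tor; the top one is used. *)
Lemma Tor_koszul (f : nat -> A) (e : int) k :
  (forall j, (j < k.+1)%N -> homogeneous e (f j) /\ (f j)@_0 = 0) ->
  (forall j, (j < k.+1)%N ->
     forall p, ideal_span f j (p * f j) -> ideal_span f j p) ->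
  Tor_neq0 (ideal_span f k.+1) k (e *+ k.+1).
Proof.
move=> hf nzd; have mg := koszul_minimal_graded hf.
have diffK0 i : diffK (koszul f e k.+1) i = 0.
  apply/matrixP=> a b; have [_ d0] := mg i.+1 a b.
  rewrite [LHS]mxE [RHS]mxE; exact: d0.
exists (koszul f e k.+1).
  split; last exact: koszul_exact.
  split=> [a|i a b]; last by have [] := mg i.+1 a b.
  by have [] := mg 0%N a ord0; rewrite subr0.
have [l shift_l] := koszul_top f e k.+1.
exists (delta_mx 0 l); split.
- by move=> a; rewrite mxE eqxx /=; case: (a =P l) => [->|_]; rewrite ?eqxx.
- case: k {nzd hf mg l shift_l} diffK0 (delta_mx _ _) => // k diffK0 v /=.
  by rewrite diffK0 mulmx0.
- move=> [w]; rewrite diffK0 mulmx0 => /matrixP/(_ 0 l)/eqP.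
  by rewrite !mxE !eqxx oner_eq0.
Qed.

End Koszul.

(** * The quadrics generating the ideal *)

Section Gram.
Variables (K : fieldType) (n m : nat).
Local Notation A := {mpoly K[n * m]}.
Local Notation var := (@var K n m).

(** The entries of [X^T X]. *)
Definition gram (j k : 'I_m) : A := \sum_(i < n) var i j * var i k.

Lemma gramC j k : gram j k = gram k j.
Proof. by apply: eq_bigr => i _; rewrite mulrC. Qed.

Lemma gram_homog j k : gram j k \is 2.-homog.
Proof.
apply: rpred_sum => i _; rewrite (@dhomogM _ _ _ 1 _ 1) //;
  by rewrite dhomogX /= mdeg1.
Qed.

Lemma GL_act_var (h : 'M[K]_m) i j :
  GL_act h (var i j) = \sum_k h k j *: var i k.
Proof.
by rewrite /GL_act /var comp_mpolyXU -tnth_nth tnth_mktuple mxvecE mxE.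
Qed.

Lemma GL_act_gram (h : 'M[K]_m) j k :
  GL_act h (gram j k) = \sum_a \sum_b (h a j * h b k)%:MP * gram a b.
Proof.
rewrite /GL_act rmorph_sum.
under eq_bigr => i _ do
  rewrite rmorphM /= -!/(GL_act h _) !GL_act_var mulr_suml.
rewrite exchange_big; apply: eq_bigr => a _ /=.
under eq_bigr do rewrite mulr_sumr.
rewrite exchange_big; apply: eq_bigr => b _ /=.
rewrite mulr_sumr; apply: eq_bigr => i _.
by rewrite -scalerAl -scalerAr scalerA mul_mpolyC.
Qed.

Hypotheses (nz2 : 2%:R != 0 :> K) (m_gt0 : (0 < m)%N).
Let j0 : 'I_m := Ordinal m_gt0.

(** The transposition of the columns [j0] and [j] maps [gram j0 j0] to
[gram j j], and the transvection adding column [k] to column [j] maps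
[gram j j] to [gram j j + gram k k + 2 gram j k]. *)
Lemma stable_ideal_gram (M : set A) : is_ideal M -> GL_stable M ->
  M (gram j0 j0) -> forall j k, M (gram j k).
Proof.
move=> [M0 MD MM] stM M00.
have MB p q : M p -> M q -> M (p - q).
  by move=> Mp Mq; apply: (MD) => //; rewrite -mulN1r; apply: MM.
have Mdiag j : M (gram j j).
  have := stM (tperm_mx j0 j) _ (unitmx_perm _ _) M00.
  rewrite GL_act_gram (bigD1 j) //= (bigD1 j) //= big1 => [|b neb].
    rewrite big1 => [|a nea].
      by rewrite !mxE tpermR !eqxx mulr1 mpolyC1 mul1r !addr0.
    apply: big1 => b _; rewrite !mxE.
    suff -> : (tperm j0 j a == j0) = false by rewrite mul0r mpolyC0 mul0r.
    by rewrite (canF_eq (tpermK j0 j)) tpermL (negPf nea).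
  rewrite !mxE.
  suff -> : (tperm j0 j b == j0) = false by rewrite mulr0 mpolyC0 mul0r.
  by rewrite (canF_eq (tpermK j0 j)) tpermL (negPf neb).
move=> j k; have [->//|ne_jk] := eqVneq j k.
pose h : 'M[K]_m := 1%:M + delta_mx k j.
have uh : h \in unitmx.
  suff /mulmx1_unit[] : h *m (1%:M - delta_mx k j) = 1%:M by [].
  rewrite mulmxDl mulmxBr mulmxBr !mul1mx mulmx1 mul_delta_mx_0 //.
  by rewrite subr0 subrK.
have hvar i : GL_act h (var i j) = var i j + var i k.
  rewrite GL_act_var (bigD1 j) //= (bigD1 k) 1?eq_sym //= big1 => [|a].
    rewrite !mxE !eqxx [k == j]eq_sym (negPf ne_jk) /=.
    by rewrite add0r !addr0 !scale1r.
  case/andP=> nea neak; rewrite !mxE (negPf nea) (negPf neak) /= addr0.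
  by rewrite scale0r.
have : GL_act h (gram j j) = gram j j + gram k k + 2%:R * gram j k.
  rewrite /GL_act rmorph_sum mulr_sumr -!big_split; apply: eq_bigr => i _ /=.
  rewrite rmorphM /= -!/(GL_act h _) !hvar; ring.
move=> act_jj; have := stM h _ uh (Mdiag j).
rewrite act_jj => /MB/(_ (MD _ _ (Mdiag j) (Mdiag k))).
rewrite addrC addKr => /(MM (2%:R^-1)%:MP).
by rewrite mulrA -mpolyC_nat -mpolyCM mulVf // mpolyC1 mul1r.
Qed.

Definition col_pairs : seq ('I_m * 'I_m) :=
  [seq jk : 'I_m * 'I_m <- enum {: 'I_m * 'I_m} | (jk.1 <= jk.2)%N].

(** The entries on and above the diagonal, listed in a fixed order; the default
value of [nth] only matters beyond the end of the list. *)
Definition quadric (i : nat) : A :=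
  let jk := nth (j0, j0) col_pairs i in gram jk.1 jk.2.

Lemma gram_in_span j k : ideal_span quadric (size col_pairs) (gram j k).
Proof.
wlog le_jk : j k / (j <= k)%N => [IH|].
  by case/orP: (leq_total j k) => /IH //; rewrite gramC.
have jk_in : (j, k) \in col_pairs by rewrite mem_filter le_jk mem_enum.
have -> : gram j k = quadric (index (j, k) col_pairs).
  by rewrite /quadric nth_index.
by apply: ideal_span_gen; rewrite index_mem.
Qed.

Lemma idealJE : idealJ m_gt0 = ideal_span quadric (size col_pairs) :> set A.
Proof.
have sum_gram : \sum_(i < n) var i j0 ^+ 2 = gram j0 j0.
  by apply: eq_bigr => i _; rewrite expr2.
apply/seteqP; split=> [p|p [b ->] M [[idM stM] sub]].
  apply; split; last by move=> _ ->; rewrite sum_gram; apply: gram_in_span.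
  split; first split.
  - exact: ideal_span0.
  - exact: ideal_spanD.
  - exact: ideal_spanM.
  move=> h _ uh [b ->]; rewrite /GL_act rmorph_sum.
  elim/big_ind: _ => [||i _]; [exact: ideal_span0|exact: ideal_spanD|].
  rewrite rmorphM /=; apply: ideal_spanM.
  rewrite -/(GL_act h _) GL_act_gram.
  elim/big_ind: _ => [||a _]; [exact: ideal_span0|exact: ideal_spanD|].
  elim/big_ind: _ => [||c _]; [exact: ideal_span0|exact: ideal_spanD|].
  exact/ideal_spanM/gram_in_span.
have [M0 MD MM] := idM.
elim/big_ind: _ => // i _; apply: MM; apply: stable_ideal_gram => //.
by apply: sub; rewrite /= sum_gram.
Qed.

Lemma size_col_pairs : (m <= size col_pairs)%N.
Proof.
rewrite -[m in (m <= _)%N]size_enum_ord -(size_map (fun j => (j, j))).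
apply: uniq_leq_size => [|_ /mapP[j _ ->]]; last first.
  by rewrite mem_filter leqnn mem_enum.
by rewrite map_inj_uniq ?enum_uniq // => j k [].
Qed.

End Gram.

(** * Specializing the quadrics to squares of variables *)

Section Substs.
Variables (K : fieldType) (N : nat).
Hypothesis nz2 : 2%:R != 0 :> K.
Local Notation A := {mpoly K[N]}.
Variable ell : 'I_N -> A.

Definition substs (s : seq 'I_N) (p : A) : A :=
  foldr (fun u => subst u (ell u)) p s.

Lemma substs_sum_mul n (p q : 'I_n -> A) s :
  substs s (\sum_i p i * q i) = \sum_i substs s (p i) * substs s (q i).
Proof.
elim: s => //= u s ->; rewrite rmorph_sum.
by apply: eq_bigr => i _; rewrite rmorphM.
Qed.

Lemma substsX s v : (forall u w, subst u (ell u) (ell w) = ell w) ->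
  substs s 'X_v = if v \in s then ell v else 'X_v.
Proof.
move=> fix_ell; elim: s => //= u s ->; rewrite inE orbC.
case: (v \in s) => /=; first exact: fix_ell.
by rewrite substX; case: eqP => // ->.
Qed.

(** One substitution at a time; where [ell u] is the variable itself, the
substitution is the identity. *)
Lemma only_koszul_substs e k (f : nat -> A) s :
  (forall u, ell u \is 1.-homog) ->
  (forall t i, substs t (f i) \is e.-homog) ->
  only_koszul_syzygies (fun i => substs s (f i)) k ->
  only_koszul_syzygies f k.
Proof.
move=> h_ell hf; elim: s => [//|u s IHs] onlyK; apply: IHs.
have [ell_u|ne_ell] := eqVneq (ell u) 'X_u; last first.
  exact: (only_koszul_subst nz2 (h_ell u) (fun i _ => hf s i) ne_ell onlyK).
move: onlyK; rewrite /= ell_u; congr only_koszul_syzygies.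
by apply/funext => i; rewrite subst_id.
Qed.

End Substs.

Section Specialization.
Variables (K : fieldType) (m : nat) (im : K).
Hypotheses (nz2 : 2%:R != 0 :> K) (im2 : im * im = -1) (m_gt0 : (0 < m)%N).
Local Notation A := {mpoly K[m * m * m]}.
Implicit Types a b j k : 'I_m.

Let lo a b := if (a <= b)%N then a else b.
Let hi a b := if (a <= b)%N then b else a.

(** The coordinate that serves as [t_{ab} = t_{ba}], up to a scalar: it lies in
the row of the ordered pair, in the column of the smaller index. *)
Definition slot a b : 'I_(m * m * m) :=
  mxvec_index (mxvec_index (lo a b) (hi a b)) (lo a b).

Lemma slotC a b : slot a b = slot b a.
Proof.
by rewrite /slot /lo /hi; case: ltngtP => // /val_inj ->.
Qed.

Lemma mxvec_index_inj n1 n2 (i i' : 'I_n1) (j j' : 'I_n2) :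
  mxvec_index i j = mxvec_index i' j' -> i = i' /\ j = j'.
Proof. by move/cast_ord_inj/enum_rank_inj => [-> ->]. Qed.

Lemma slot_inj a b j k : (a <= b)%N -> (j <= k)%N ->
  slot a b = slot j k -> (a, b) = (j, k).
Proof.
rewrite /slot /lo /hi => -> ->.
by move=> /mxvec_index_inj[/mxvec_index_inj[-> ->]].
Qed.

(** The entry of [X] in the position [slot a a] is specialized to
[(1 + im) t_{aa}]; this scalar makes it equal to the variable itself, so that
the specialization fixes all the variables it involves ([special_slot]). *)
Definition weight a b : K := if a == b then (1 + im)^-1 else 1.

Lemma im1_neq0 : 1 + im != 0.
Proof.
apply: contra_neq nz2 => e; transitivity ((1 + im) * (1 - im)).
  by rewrite mulrBr mulr1 mulrDl mul1r im2; ring.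
by rewrite e mul0r.
Qed.

Lemma im_neq0 : im != 0.
Proof.
apply: contra_eq_neq im2 => ->; rewrite mul0r eq_sym oppr_eq0.
exact: oner_neq0.
Qed.

Lemma weight_neq0 a b : weight a b != 0.
Proof.
by rewrite /weight; case: ifP => _; rewrite ?invr_neq0 ?im1_neq0 ?oner_neq0.
Qed.

(** Column [j] of the specialized matrix, arranged as an [m] x [m] matrix since
rows are indexed by pairs. *)
Definition cell j : 'M[A]_m := \matrix_(a, b)
  (((j == a)%:R + im * (j == b)%:R) * weight a b *: 'X_(slot a b)).

Definition special (u : 'I_(m * m * m)) : A :=
  mxvec (\matrix_(r, j) mxvec (cell j) 0 r) 0 u.

Lemma specialE a b j :
  special (mxvec_index (mxvec_index a b) j) = cell j a b.
Proof. by rewrite /special mxvecE mxE mxvecE. Qed.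

Lemma special_form u : exists c a b, special u = c *: 'X_(slot a b).
Proof.
case/mxvec_indexP: u => r j; case/mxvec_indexP: r => a b.
by rewrite specialE mxE; do 3!eexists.
Qed.

Lemma special_slot a b : special (slot a b) = 'X_(slot a b).
Proof.
wlog le_ab : a b / (a <= b)%N => [IH|].
  by case/orP: (leq_total a b) => /IH //; rewrite slotC.
rewrite {1}/slot specialE mxE /lo /hi le_ab eqxx /weight.
case: eqP => [->|_]; last by rewrite mulr0 addr0 mulr1 scale1r.
by rewrite mulr1 divff ?im1_neq0 // scale1r.
Qed.

Lemma special_fixed u w : subst u (special u) (special w) = special w.
Proof.
have [c [a [b ->]]] := special_form w; rewrite linearZ /= substX.
by case: eqP => // <-; rewrite special_slot.
Qed.

Lemma special_homog u : special u \is 1.-homog.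
Proof.
have [c [a [b ->]]] := special_form u.
by apply: rpredZ; rewrite dhomogX /= mdeg1.
Qed.

Lemma substs_gram_homog s j k :
  substs special s (@gram K (m * m) m j k) \is 2.-homog.
Proof.
rewrite substs_sum_mul; apply: rpred_sum => i _.
have h v : substs special s 'X_v \is 1.-homog.
  rewrite substsX; last exact: special_fixed.
  by case: ifP => _; [exact: special_homog | rewrite dhomogX /= mdeg1].
exact: (dhomogM (h _) (h _)).
Qed.

(** Writing [D j a] for the Kronecker delta, the product of two entries in row
[(a, b)] expands into four terms. Those with [D j a * D k a] and
[- D j b * D k b] cancel in the sum over [a] and [b] by the symmetry of
[t a b], and each of the two mixed terms contributes [im * t j k]. *)
Lemma specialize_gram j k :
  substs special (enum 'I_(m * m * m)) (@gram K (m * m) m j k) =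
  (2%:R * im * weight j k ^+ 2) *: 'X_(slot j k) ^+ 2.
Proof.
rewrite substs_sum_mul.
under eq_bigr do rewrite !(substsX _ _ special_fixed) !mem_enum /=.
transitivity (\sum_a \sum_b cell j a b * cell k a b).
  rewrite pair_bigA (reindex _ (curry_mxvec_bij m m)) /=.
  by apply: eq_bigr => -[a b] _ /=; rewrite !specialE.
pose t a b : A := (weight a b *: 'X_(slot a b)) ^+ 2.
have tC a b : t a b = t b a by rewrite /t /weight slotC eq_sym.
pose D j a : A := (j == a)%:R.
have sumD x (F : 'I_m -> A) : \sum_a D x a * F a = F x.
  rewrite (bigD1 x) //= /D eqxx mul1r big1 ?addr0 // => a.
  by rewrite eq_sym => /negPf->; rewrite mul0r.
transitivity (\sum_a \sum_b (D j a * (D k a * t a b)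
    - D j b * (D k b * t a b) + im%:MP * (D j a * (D k b * t a b))
    + im%:MP * (D j b * (D k a * t a b)))).
  apply: eq_bigr => a _; apply: eq_bigr => b _.
  have im2' : im%:MP * im%:MP = -1 :> A by rewrite -mpolyCM im2 mpolyCN mpolyC1.
  rewrite !mxE -!scalerA -!mul_mpolyC.
  rewrite !mpolyCD !mpolyCM !mpolyC_nat -!/(D _ _) /t -mul_mpolyC.
  ring: im2'.
under eq_bigr do rewrite 2!big_split sumrB /=.
rewrite 2!big_split sumrB /=.
have -> : \sum_a \sum_b D j a * (D k a * t a b) =
          \sum_a \sum_b D j b * (D k b * t a b).
  rewrite [RHS]exchange_big; apply: eq_bigr => a _.
  by apply: eq_bigr => b _; rewrite tC.
rewrite subrr add0r.
under eq_bigr do rewrite -mulr_sumr -mulr_sumr sumD.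
under [X in _ + X]eq_bigr do rewrite -mulr_sumr sumD.
rewrite -!mulr_sumr !sumD [t k j]tC /t exprZn -!mul_mpolyC.
rewrite !mpolyCM mpolyC_nat; ring.
Qed.

Lemma only_koszul_quadrics c : (c <= size (col_pairs m))%N ->
  only_koszul_syzygies (@quadric K (m * m) m m_gt0) c.
Proof.
move=> le_c; pose x0 : 'I_m * 'I_m := (Ordinal m_gt0, Ordinal m_gt0).
pose P i := nth x0 (col_pairs m) i.
pose s0 := enum 'I_(m * m * m).
apply: (only_koszul_substs nz2 special_homog (s := s0)) => [s i|].
  exact: substs_gram_homog.
have -> : (fun i => substs special s0 (quadric K (m * m) m_gt0 i)) =
    (fun i => (2%:R * im * weight (P i).1 (P i).2 ^+ 2) *:
              'X_(slot (P i).1 (P i).2) ^+ 2).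
  by apply/funext => i; rewrite specialize_gram.
apply: only_koszul_squares => [i _|i j lt_i lt_j].
  by rewrite !mulf_neq0 ?expf_neq0 ?weight_neq0 ?im_neq0.
have PP l : (l < c)%N -> P l \in col_pairs m.
  by move=> lt_lc; rewrite mem_nth // (leq_trans lt_lc).
have := PP i lt_i; have := PP j lt_j.
rewrite !mem_filter => /andP[le_j _] /andP[le_i _].
move=> /(slot_inj le_i le_j); rewrite -!surjective_pairing => /eqP.
have uniq_pairs : uniq (col_pairs m) by apply/filter_uniq/enum_uniq.
by rewrite nth_uniq ?(leq_trans lt_i) ?(leq_trans lt_j) // => /eqP.
Qed.

Lemma Tor_idealJ : exists2 c, (m <= c.+1)%N &
  Tor_neq0 (@idealJ K (m * m) m m_gt0) c (2 *+ c.+1).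
Proof.
rewrite idealJE //; have := size_col_pairs m.
case def_c: (size _) => [|c] le_mc; first by rewrite leqNgt m_gt0 in le_mc.
exists c => //; apply: Tor_koszul => [j _|j lt_jc p].
  have hq : quadric K (m * m) m_gt0 j \is 2.-homog by apply: gram_homog.
  split=> [u u_in|]; first by rewrite (dhomog_mf hq).
  by apply: (dhomog_nemf_coeff hq); rewrite /= mdeg0.
apply: only_koszul_syzygies_nonzerodivisor; first exact: mpoly_nz2.
by apply: only_koszul_quadrics; rewrite def_c.
Qed.

End Specialization.

(** * Unboundedness *)

Theorem mainTheorem3 (R : realType) (B : int) :
  exists (n m : nat) (m_gt0 : (0 < m)%N),
    (0 < n)%N /\
    (((B%:~R)%R : R)%:E < regularity R (@idealJ (complex R) n m m_gt0))%E.
Proof.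
have im2 : ('i * 'i = -1 :> complex R)%C by rewrite -expr2 sqr_i.
have nz2 : 2%:R != 0 :> complex R by rewrite pnatr_eq0.
pose m := (absz B).+1.
have m_gt0 : (0 < m)%N by [].
have [c le_mc tor] := Tor_idealJ nz2 im2 m_gt0.
exists (m * m)%N, m, m_gt0; split=> //.
(* The top class has degree 2 (c + 1) in homological degree c. *)
have val_c : 2 *+ c.+1 - c%:Z = c.+2%:Z by rewrite -mulr_natr; lia.
apply: (@lt_le_trans _ _ (((2 *+ c.+1 - c%:Z)%:~R : R)%:E)).
  by rewrite lte_fin ltr_int val_c; lia.
by apply: ereal_sup_ubound; exists (c, 2 *+ c.+1).
Qed.
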